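(* Let $n\ge 2$ be an integer, let $K$ be a commutative ring in which $n!$ is invertible, let $\mathcal{C}$ be a $K$-linear symmetric monoidal category and let $X\in\mathcal{C}$. If $\wedge^n X$ is invertible, then $X$ is rigid.
   Context: In a $K$-linear symmetric monoidal category the Hom sets are $K$-modules and composition and $\otimes$ are $K$-bilinear. The unit is $\mathbf{1}$ and the braiding is $\sigma_{X,Y}:X\otimes Y\to Y\otimes X$. The braiding gives an action of the symmetric group $S_n$ on $X^{\otimes n}$. The exterior power $\wedge^n X$ is the direct summand of $X^{\otimes n}$ corresponding to the idempotent $e_n=\frac{1}{n!}\sum_{x\in S_n}(-1)^{|x|}x$, where $(-1)^{|x|}$ is the sign of $x$. (A $K$-linear symmetric monoidal category can be canonically completed by formally adjoining direct summands and direct sums; in general the summand $\wedge^nX$ is the object $(X^{\otimes n},e_n)$ of this completion.) An object $L$ is invertible if there is an object $L'$ with $L\otimes L'\simeq\mathbf{1}$. An object $X$ is rigid if it has a dual, i.e. there are an object $X^\ast$ and morphisms $\mathrm{ev}_X:X^\ast\otimes X\to\mathbf{1}$, $\mathrm{co}_X:\mathbf{1}\to X\otimes X^\ast$ with $(X\otimes\mathrm{ev}_X)\circ(\mathrm{co}_X\otimes X)=\mathrm{id}_X$ and $(\mathrm{ev}_X\otimes X^\ast)\circ(X^\ast\otimes\mathrm{co}_X)=\mathrm{id}_{X^\ast}$.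
   Formalization: Rigidity of X is asserted in the completion of C by direct sums and summands, not in C itself: in C it can fail, e.g. for the tensor powers of the standard representation V of SL_3 over Q, where ∧^3 V is the unit but V has no dual among them. *)

(* Defs.v *)
From HB Require Import structures.
From mathcomp Require Import all_boot all_fingroup all_algebra.
From mathcomp Require Import zify.

Set Implicit Arguments.
Unset Strict Implicit.
Unset Printing Implicit Defensive.

Import GRing.Theory.
Local Open Scope ring_scope.

Declare Scope cat_scope.
Delimit Scope cat_scope with cat.
Local Open Scope cat_scope.

Record smc_data (K : comPzRingType) := SmcData {
  obj :> Type;
  hom : obj -> obj -> lmodType K;
  idm : forall X, hom X X;
  comp : forall X Y Z, hom Y Z -> hom X Y -> hom X Z;
  unit_obj : obj;
  tens : obj -> obj -> obj;
  tensm : forall X X' Y Y', hom X X' -> hom Y Y' -> hom (tens X Y) (tens X' Y');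
  assoc : forall X Y Z, hom (tens (tens X Y) Z) (tens X (tens Y Z));
  associ : forall X Y Z, hom (tens X (tens Y Z)) (tens (tens X Y) Z);
  lunit : forall X, hom (tens unit_obj X) X;
  luniti : forall X, hom X (tens unit_obj X);
  runit : forall X, hom (tens X unit_obj) X;
  runiti : forall X, hom X (tens X unit_obj);
  braid : forall X Y, hom (tens X Y) (tens Y X) }.

Arguments hom {K s} X Y.
Arguments idm {K s} X.
Arguments comp {K s X Y Z} g f.
Arguments unit_obj {K s}.
Arguments tens {K s} X Y.
Arguments tensm {K s X X' Y Y'} f g.
Arguments assoc {K s} X Y Z.
Arguments associ {K s} X Y Z.
Arguments lunit {K s} X.
Arguments luniti {K s} X.
Arguments runit {K s} X.
Arguments runiti {K s} X.
Arguments braid {K s} X Y.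

Notation "g \oc f" := (comp g f) (at level 40, left associativity) : cat_scope.
Notation "X \ox Y" := (tens X Y) (at level 35, right associativity) : cat_scope.
Notation "f \om g" := (tensm f g) (at level 35, right associativity) : cat_scope.

Record smc_laws (K : comPzRingType) (C : smc_data K) : Prop := SmcLaws {
  comp1m : forall (X Y : C) (f : hom X Y), idm Y \oc f = f;
  compm1 : forall (X Y : C) (f : hom X Y), f \oc idm X = f;
  compA : forall (X Y Z W : C) (h : hom Z W) (g : hom Y Z) (f : hom X Y),
    h \oc (g \oc f) = (h \oc g) \oc f;
  comp_linearl : forall (X Y Z : C) (f : hom X Y) (a : K) (g g' : hom Y Z),
    (a *: g + g') \oc f = a *: (g \oc f) + g' \oc f;
  comp_linearr : forall (X Y Z : C) (g : hom Y Z) (a : K) (f f' : hom X Y),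
    g \oc (a *: f + f') = a *: (g \oc f) + g \oc f';
  tensm_linearl : forall (X X' Y Y' : C) (g : hom Y Y') (a : K)
      (f f' : hom X X'),
    (a *: f + f') \om g = a *: (f \om g) + f' \om g;
  tensm_linearr : forall (X X' Y Y' : C) (f : hom X X') (a : K)
      (g g' : hom Y Y'),
    f \om (a *: g + g') = a *: (f \om g) + f \om g';
  tensm1 : forall X Y : C, idm X \om idm Y = idm (X \ox Y);
  tensm_comp : forall (X X' X'' Y Y' Y'' : C) (f' : hom X' X'') (f : hom X X')
      (g' : hom Y' Y'') (g : hom Y Y'),
    (f' \oc f) \om (g' \oc g) = (f' \om g') \oc (f \om g);
  assocK : forall X Y Z : C,
    associ X Y Z \oc assoc X Y Z = idm ((X \ox Y) \ox Z);
  associK : forall X Y Z : C,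
    assoc X Y Z \oc associ X Y Z = idm (X \ox (Y \ox Z));
  lunitK : forall X : C, luniti X \oc lunit X = idm (unit_obj \ox X);
  lunitiK : forall X : C, lunit X \oc luniti X = idm X;
  runitK : forall X : C, runiti X \oc runit X = idm (X \ox unit_obj);
  runitiK : forall X : C, runit X \oc runiti X = idm X;
  assoc_nat : forall (X X' Y Y' Z Z' : C) (f : hom X X') (g : hom Y Y')
      (h : hom Z Z'),
    assoc X' Y' Z' \oc ((f \om g) \om h) = (f \om (g \om h)) \oc assoc X Y Z;
  lunit_nat : forall (X X' : C) (f : hom X X'),
    lunit X' \oc (idm unit_obj \om f) = f \oc lunit X;
  runit_nat : forall (X X' : C) (f : hom X X'),
    runit X' \oc (f \om idm unit_obj) = f \oc runit X;
  braid_nat : forall (X X' Y Y' : C) (f : hom X X') (g : hom Y Y'),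
    braid X' Y' \oc (f \om g) = (g \om f) \oc braid X Y;
  braidK : forall X Y : C, braid Y X \oc braid X Y = idm (X \ox Y);
  triangle : forall X Y : C,
    (idm X \om lunit Y) \oc assoc X unit_obj Y = runit X \om idm Y;
  pentagon : forall X Y Z W : C,
    (idm X \om assoc Y Z W) \oc assoc X (Y \ox Z) W \oc (assoc X Y Z \om idm W)
    = assoc X Y (Z \ox W) \oc assoc (X \ox Y) Z W;
  hexagon : forall X Y Z : C,
    assoc Y Z X \oc braid X (Y \ox Z) \oc assoc X Y Z
    = (idm Y \om braid X Z) \oc assoc Y X Z \oc (braid X Y \om idm Z) }.

(* K-linear symmetric monoidal categories, not assumed strict. *)
Record sym_mon_cat (K : comPzRingType) := SymMonCat {
  smc_of :> smc_data K;
  smcP : smc_laws smc_of }.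

Section Theory.
Variables (K : comPzRingType) (C : sym_mon_cat K).
Implicit Types X Y Z W : C.
Let L := smcP C.

Lemma cm1 X Y (f : hom X Y) : f \oc idm X = f. Proof. exact: compm1 L _ _ _. Qed.
Lemma c1m X Y (f : hom X Y) : idm Y \oc f = f. Proof. exact: comp1m L _ _ _. Qed.
Lemma cA X Y Z W (h : hom Z W) (g : hom Y Z) (f : hom X Y) :
  h \oc (g \oc f) = (h \oc g) \oc f.
Proof. exact: compA. Qed.
Lemma tc X X' X'' Y Y' Y'' (f' : hom X' X'') (f : hom X X')
    (g' : hom Y' Y'') (g : hom Y Y') :
  (f' \om g') \oc (f \om g) = (f' \oc f) \om (g' \oc g).
Proof. by rewrite (tensm_comp L). Qed.
Lemma t11 X Y : idm X \om idm Y = idm (X \ox Y). Proof. exact: tensm1. Qed.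

Lemma compDl X Y Z (f : hom X Y) (g g' : hom Y Z) :
  (g + g') \oc f = g \oc f + g' \oc f.
Proof. by rewrite -{1}[g]scale1r (comp_linearl L) scale1r. Qed.
Lemma comp0l X Y Z (f : hom X Y) : (0 : hom Y Z) \oc f = 0.
Proof. by apply: (addrI (0 \oc f)); rewrite -compDl !addr0. Qed.
Lemma compZl X Y Z (f : hom X Y) a (g : hom Y Z) : (a *: g) \oc f = a *: (g \oc f).
Proof. by rewrite -[a *: g]addr0 (comp_linearl L) comp0l addr0. Qed.
Lemma compDr X Y Z (g : hom Y Z) (f f' : hom X Y) :
  g \oc (f + f') = g \oc f + g \oc f'.
Proof. by rewrite -{1}[f]scale1r (comp_linearr L) scale1r. Qed.
Lemma comp0r X Y Z (g : hom Y Z) : g \oc (0 : hom X Y) = 0.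
Proof. by apply: (addrI (g \oc 0)); rewrite -compDr !addr0. Qed.
Lemma compZr X Y Z (g : hom Y Z) a (f : hom X Y) : g \oc (a *: f) = a *: (g \oc f).
Proof. by rewrite -[a *: f]addr0 (comp_linearr L) comp0r addr0. Qed.
Lemma tensDl X X' Y Y' (g : hom Y Y') (f f' : hom X X') :
  (f + f') \om g = f \om g + f' \om g.
Proof. by rewrite -{1}[f]scale1r (tensm_linearl L) scale1r. Qed.
Lemma tens0l X X' Y Y' (g : hom Y Y') : (0 : hom X X') \om g = 0.
Proof. by apply: (addrI (0 \om g)); rewrite -tensDl !addr0. Qed.
Lemma tensDr X X' Y Y' (f : hom X X') (g g' : hom Y Y') :
  f \om (g + g') = f \om g + f \om g'.
Proof. by rewrite -{1}[g]scale1r (tensm_linearr L) scale1r. Qed.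
Lemma tens0r X X' Y Y' (f : hom X X') : f \om (0 : hom Y Y') = 0.
Proof. by apply: (addrI (f \om 0)); rewrite -tensDr !addr0. Qed.

Lemma comp_suml X Y Z (f : hom X Y) (I : finType) (g : I -> hom Y Z) :
  (\sum_i g i) \oc f = \sum_i (g i \oc f).
Proof.
by apply: (big_morph (fun h : hom Y Z => h \oc f));
  [move=> u v; exact: compDl | exact: comp0l].
Qed.
Lemma comp_sumr X Y Z (g : hom Y Z) (I : finType) (f : I -> hom X Y) :
  g \oc (\sum_i f i) = \sum_i (g \oc f i).
Proof.
by apply: (big_morph (fun h : hom X Y => g \oc h));
  [move=> u v; exact: compDr | exact: comp0r].
Qed.
Lemma tens_suml X X' Y Y' (g : hom Y Y') (I : finType) (f : I -> hom X X') :
  (\sum_i f i) \om g = \sum_i (f i \om g).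
Proof.
by apply: (big_morph (fun h : hom X X' => h \om g));
  [move=> u v; exact: tensDl | exact: tens0l].
Qed.
Lemma tens_sumr X X' Y Y' (f : hom X X') (I : finType) (g : I -> hom Y Y') :
  f \om (\sum_i g i) = \sum_i (f \om g i).
Proof.
by apply: (big_morph (fun h : hom Y Y' => f \om h));
  [move=> u v; exact: tensDr | exact: tens0r].
Qed.

Definition isomorphic X Y : Prop :=
  exists (f : hom X Y) (g : hom Y X), g \oc f = idm X /\ f \oc g = idm Y.

Definition invertible X : Prop := exists X' : C, isomorphic (X \ox X') unit_obj.

Definition rigid X : Prop :=
  exists (Xd : C) (ev : hom (Xd \ox X) unit_obj) (co : hom unit_obj (X \ox Xd)),
    runit X \oc (idm X \om ev) \oc assoc X Xd X \oc (co \om idm X) \oc luniti X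
      = idm X
    /\ lunit Xd \oc (ev \om idm Xd) \oc associ Xd X Xd \oc (idm Xd \om co)
         \oc runiti Xd
      = idm Xd.

Fixpoint tpow X n : C :=
  if n is m.+1 then X \ox tpow X m else unit_obj.

Definition swap X Y Z : hom (X \ox (Y \ox Z)) (Y \ox (X \ox Z)) :=
  assoc Y X Z \oc (braid X Y \om idm Z) \oc associ X Y Z.

(* Moves the leftmost factor of the power to position j (for j <= n). *)
Fixpoint insert X n (j : nat) {struct n} : hom (tpow X n.+1) (tpow X n.+1) :=
  match n, j with
  | m.+1, k.+1 => (idm X \om insert X m k) \oc swap X X (tpow X m)
  | _, _ => idm _
  end.

(* The braiding of the factors in positions i and i.+1 (for i.+1 < n). *)
Fixpoint adj_braid X n (i : nat) : hom (tpow X n) (tpow X n) :=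
  match n with
  | 0 => idm _
  | m.+1 =>
    match i with
    | k.+1 => idm X \om adj_braid X m k
    | 0 => match m return hom (X \ox tpow X m) (X \ox tpow X m) with
           | p.+1 => swap X X (tpow X p)
           | 0 => idm _
           end
    end
  end.

End Theory.


Section SwapTheory.
Variables (K : comPzRingType) (C : sym_mon_cat K).
Implicit Types X Y Z W : C.
Let L := smcP C.

Lemma t1c X X' Y Y' Y'' (f : hom X X') (g' : hom Y' Y'') (g : hom Y Y') :
  f \om (g' \oc g) = (f \om g') \oc (idm X \om g).
Proof. by rewrite tc cm1. Qed.

Lemma t1c1 X Y Y' Y'' (g' : hom Y' Y'') (g : hom Y Y') :
  idm X \om (g' \oc g) = (idm X \om g') \oc (idm X \om g).
Proof. by rewrite tc cm1. Qed.

Lemma tc11 X Y Y' Y'' (g' : hom Y' Y'') (g : hom Y Y') :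
  (g' \oc g) \om idm X = (g' \om idm X) \oc (g \om idm X).
Proof. by rewrite tc cm1. Qed.

Lemma associ_nat X X' Y Y' Z Z' (f : hom X X') (g : hom Y Y') (h : hom Z Z') :
  associ X' Y' Z' \oc (f \om (g \om h)) = ((f \om g) \om h) \oc associ X Y Z.
Proof.
rewrite -[LHS]cm1 -(associK L) !cA -(cA (associ _ _ _)) -(assoc_nat L).
by rewrite !cA (assocK L) c1m.
Qed.

Lemma swap_nat X X' Y Y' Z Z' (f : hom X X') (g : hom Y Y') (h : hom Z Z') :
  swap X' Y' Z' \oc (f \om (g \om h)) = (g \om (f \om h)) \oc swap X Y Z.
Proof.
rewrite /swap -cA associ_nat cA -(cA (assoc _ _ _)) tc (braid_nat L) c1m.
by rewrite -[h in (_ \oc _) \om h]cm1 -tc !cA (assoc_nat L) -!cA.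
Qed.

Lemma swapK X Y Z : swap Y X Z \oc swap X Y Z = idm _.
Proof.
rewrite /swap !cA -(cA _ (associ _ _ _)) (assocK L) cm1 -(cA _ (_ \om _) (_ \om _)) tc.
by rewrite (braidK L) c1m t11 cm1 (associK L).
Qed.

Lemma swap_assoc X Y Z : swap X Y Z \oc assoc X Y Z = assoc Y X Z \oc (braid X Y \om idm Z).
Proof. by rewrite /swap -cA (assocK L) cm1. Qed.

Lemma epi_assoc X Y Z W (f g : hom (X \ox (Y \ox Z)) W) :
  f \oc assoc X Y Z = g \oc assoc X Y Z -> f = g.
Proof.
by move=> E; rewrite -[f]cm1 -[g]cm1 -(associK L) !cA E.
Qed.

Lemma epi_assoc1 X Y Z W V (f g : hom ((X \ox (Y \ox Z)) \ox V) W) :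
  f \oc (assoc X Y Z \om idm V) = g \oc (assoc X Y Z \om idm V) -> f = g.
Proof.
move=> E; rewrite -[f]cm1 -[g]cm1 -t11 -(associK L) tc11 !cA; by rewrite E.
Qed.

Lemma asc X Y Z W (a : hom Y Z) (b : hom X Y) (c : hom X Z) (x : hom Z W) :
  a \oc b = c -> x \oc a \oc b = x \oc c.
Proof. by move=> <-; rewrite cA. Qed.

Lemma swap_hexagon X Y W Z :
  (idm Y \om swap X W Z) \oc swap X Y (W \ox Z) \oc (idm X \om assoc Y W Z)
  = assoc Y W (X \ox Z) \oc swap X (Y \ox W) Z.
Proof.
move: (@swap K C) swap_assoc => sw swA; apply: epi_assoc; apply: epi_assoc1.
transitivity ((idm Y \om (assoc W X Z \oc (braid X W \om idm Z)))
    \oc assoc Y (X \ox W) Z \oc (assoc Y X W \om idm Z)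
    \oc ((braid X Y \om idm W) \om idm Z)).
  rewrite -[LHS]cA -[LHS]cA (cA (idm X \om _)) (pentagon L) !cA.
  rewrite (asc _ (swA _ _ _)) !cA -t11.
  rewrite (asc _ (esym (assoc_nat L _ _ _))) !cA.
  rewrite (asc _ (esym (pentagon L _ _ _ _))) !cA tc c1m.
  by rewrite -(swA X W Z).
rewrite (asc _ (swA _ _ _)) !cA -(pentagon L).
rewrite t1c1 (asc _ (esym (assoc_nat L _ _ _))) !cA.
rewrite !(asc _ (esym (tc11 _ _ _))).
by rewrite -!cA; congr (_ \oc (_ \oc (_ \om _))); rewrite !cA (hexagon L).
Qed.

Lemma swap_braid X Y W Z :
  (idm W \om swap X Y Z) \oc swap X W (Y \ox Z) \oc (idm X \om swap Y W Z)
  = swap Y W (X \ox Z) \oc (idm Y \om swap X W Z) \oc swap X Y (W \ox Z).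
Proof.
have E : idm X \om swap Y W Z = (idm X \om assoc W Y Z) \oc
    (idm X \om (braid Y W \om idm Z)) \oc (idm X \om associ Y W Z).
  by rewrite -!t1c1.
move: (@swap K C) swap_assoc (@swap_nat) swap_hexagon E => sw swA swN swH E.
rewrite E !cA swH (asc _ (swN _ _ _ _ _ _ _ _ _)) t11.
transitivity (sw Y W (X \ox Z) \oc (assoc Y W (X \ox Z) \oc sw X (Y \ox W) Z)
   \oc (idm X \om associ Y W Z)).
  by rewrite !cA swA.
by rewrite -swH -!cA -t1c1 (associK L) t11 cm1.
Qed.

End SwapTheory.

Section PermRest.
Variable n : nat.

Definition perm_rest_fun (s : 'S_n.+1) (k : 'I_n) : 'I_n :=
  odflt k (unlift (s ord0) (s (lift ord0 k))).

Lemma perm_rest_funE (s : 'S_n.+1) k :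
  lift (s ord0) (perm_rest_fun s k) = s (lift ord0 k).
Proof.
rewrite /perm_rest_fun; case: unliftP => [j -> //| E].
by move/perm_inj: E => E; have := neq_lift ord0 k; rewrite E eqxx.
Qed.

Lemma perm_rest_inj (s : 'S_n.+1) : injective (perm_rest_fun s).
Proof.
move=> k l E; apply: (@lift_inj _ ord0); apply: (@perm_inj _ s).
by rewrite -!perm_rest_funE E.
Qed.

(* The bijection between the complements of ord0 and of s ord0 induced by s,
   seen as a permutation of 'I_n through the increasing enumerations. *)
Definition perm_rest (s : 'S_n.+1) : 'S_n := perm (@perm_rest_inj s).

Lemma perm_restK (s : 'S_n.+1) : lift_perm ord0 (s ord0) (perm_rest s) = s.
Proof.
apply/permP => k; case: (unliftP ord0 k) => [j ->|->]; last by rewrite lift_perm_id.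
by rewrite lift_perm_lift permE perm_rest_funE.
Qed.

Lemma lift_permK (j : 'I_n.+1) (s : 'S_n) : perm_rest (lift_perm ord0 j s) = s.
Proof.
apply/permP => k; apply: (@lift_inj _ j).
have := perm_rest_funE (lift_perm ord0 j s) k.
rewrite lift_perm_id lift_perm_lift => <-; congr (lift _ _); exact: permE.
Qed.

End PermRest.

Section SymAct.
Variables (K : comPzRingType) (C : sym_mon_cat K) (X : C).

(* The action of 'S_n on the n-th tensor power given by the braiding: s moves
   the factor in position i to position s i.  By sym_actM and sym_act_tperm below
   it is the action in which adjacent transpositions act by the braiding of two
   neighbouring factors; s * u applies s first. *)
Fixpoint sym_act n : 'S_n -> hom (tpow X n) (tpow X n) :=
  match n return 'S_n -> hom (tpow X n) (tpow X n) with
  | 0 => fun _ => idm _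
  | m.+1 => fun s => insert X m (s ord0) \oc (idm X \om sym_act (perm_rest s))
  end.


Local Notation tp n := (tpow X n).
Local Open Scope nat_scope.

Lemma adj_braidK n i : adj_braid X n i \oc adj_braid X n i = idm _.
Proof.
elim: n i => [|n IH] [|i] /=; rewrite ?cm1 //.
  by case: n {IH} => [|n]; [rewrite cm1 | exact: swapK].
by rewrite -t1c1 IH t11.
Qed.

Lemma insertS n j : j < n ->
  adj_braid X n.+1 j \oc insert X n j = insert X n j.+1.
Proof.
elim: n j => // n IH [|j] /= ltjn; first by case: n {IH ltjn} => [|n] /=; rewrite ?t11 ?cm1 ?c1m.
by rewrite cA -t1c1 IH.
Qed.

Lemma insert_pred n j : j < n ->
  adj_braid X n.+1 j \oc insert X n j.+1 = insert X n j.
Proof. by move=> ltjn; rewrite -insertS // cA adj_braidK c1m. Qed.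

Lemma insert_gt n j i : j < i -> i < n ->
  adj_braid X n.+1 i \oc insert X n j
  = insert X n j \oc (idm X \om adj_braid X n i.-1).
Proof.
elim: n j i => // n IH [|j] [|i] //= ltji ltin; first by rewrite cm1 c1m.
case: i ltji ltin => // i ltji ltin.
have := IH j i.+1 ltji ltin => /= {}IH.
by rewrite cA -t1c1 IH t1c1 (asc _ (swap_nat _ _ _)) cA.
Qed.

Lemma insert_lt n j i : i.+1 < j -> j <= n ->
  adj_braid X n.+1 i \oc insert X n j
  = insert X n j \oc (idm X \om adj_braid X n i).
Proof.
elim: n j i => [|n IH] [|j] [|i] //= ltij lejn.
  case: n j ltij lejn {IH} => [|n] [|j] //= _ _.
  move: (swap_braid X X X (tp n)) (@swap_nat K C).
  move: (@swap K C) => sw swB swN.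
  by rewrite t1c1 !cA swN -!cA; congr (_ \oc _); move: swB; rewrite -!cA => ->.
have := IH j i ltij lejn => /= {}IH.
by rewrite cA -t1c1 IH t1c1 (asc _ (swap_nat _ _ _)) cA.
Qed.

Definition adj_tperm n i : 'S_n.+1 := tperm (inord i) (inord i.+1).

Lemma sym_act_lift n j (s : 'S_n) :
  sym_act (lift_perm ord0 j s) = insert X n j \oc (idm X \om sym_act s).
Proof. by rewrite /= lift_permK lift_perm_id. Qed.

Lemma val_adj_tperm n i (k : 'I_n.+1) : i < n ->
  adj_tperm n i k
    = (if k == i :> nat then i.+1 else if k == i.+1 :> nat then i else k) :> nat.
Proof.
move=> ltin; rewrite /adj_tperm.
have Ei : (inord i : 'I_n.+1) = i :> nat by rewrite inordK //; lia.
have Ei1 : (inord i.+1 : 'I_n.+1) = i.+1 :> nat by rewrite inordK //; lia.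
case: tpermP => [->|->|]; rewrite ?Ei ?Ei1 ?eqxx //.
  by case: ifP => //; lia.
move=> /eqP; rewrite -val_eqE /= inordK; last lia.
move/negPf=> -> /eqP; rewrite -val_eqE /= inordK; last lia.
by move/negPf => ->.
Qed.

Lemma lift_adj n (j j' : 'I_n.+1) (s : 'S_n) i : i < n ->
  j' = adj_tperm n i j -> (j == i :> nat) || (j == i.+1 :> nat) ->
  (lift_perm ord0 j s * adj_tperm n i)%g = lift_perm ord0 j' s.
Proof.
move=> ltin -> ji; apply/permP => k; rewrite permM.
case: (unliftP ord0 k) => [l ->|->]; last by rewrite !lift_perm_id.
rewrite !lift_perm_lift; apply: val_inj; rewrite /= !val_adj_tperm // /= /bump.
move: (nat_of_ord j) (nat_of_ord (s l)) ji => a b.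
by repeat (case: ifP => /= ?); lia.
Qed.

Lemma lift_adj2 n (j : 'I_n.+2) (s : 'S_n.+1) i i' : i < n.+1 -> i' < n ->
  (i == (j <= i') + i')%N -> j != i'.+1 :> nat ->
  (lift_perm ord0 j s * adj_tperm n.+1 i)%g
    = lift_perm ord0 j (s * adj_tperm n i')%g.
Proof.
move=> ltin ltin' /eqP ii' ji; apply/permP => k; rewrite permM.
case: (unliftP ord0 k) => [l ->|->]; apply: val_inj.
  rewrite !lift_perm_lift !permM /= !val_adj_tperm // /= /bump ii'.
  move: (nat_of_ord j) (nat_of_ord (s l)) ji => a b.
  by repeat (case: ifP => /= ?); lia.
rewrite !lift_perm_id /= val_adj_tperm // ii'.
move: (nat_of_ord j) ji => a.
by repeat (case: ifP => /= ?); lia.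
Qed.

Lemma sym_act_adj n (s : 'S_n.+1) i : i < n ->
  sym_act (s * adj_tperm n i)%g = adj_braid X n.+1 i \oc sym_act s.
Proof.
elim: n s i => // n IH s i ltin; rewrite -(perm_restK s).
move: (s ord0) (perm_rest s) => j {}s; rewrite [in RHS]sym_act_lift [RHS]cA.
have [ji|] := boolP ((j == i :> nat) || (j == i.+1 :> nat)).
  rewrite (lift_adj s ltin (erefl _) ji) sym_act_lift val_adj_tperm //.
  case/orP: ji => /eqP->; first by rewrite eqxx insertS.
  by rewrite eqxx insert_pred //; case: ifP => //; lia.
rewrite negb_or => /andP[ji ji1].
have [ltji|leij] := ltnP j i.
  rewrite insert_gt // -cA -t1c1 -IH; last by lia.
  by rewrite (@lift_adj2 _ _ _ i i.-1) // ?sym_act_lift //; lia.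
have lt2 : i.+1 < j by lia.
have ltj := ltn_ord j.
rewrite insert_lt // -cA -t1c1 -IH; last by lia.
by rewrite (@lift_adj2 _ _ _ i i) // ?sym_act_lift //; lia.
Qed.

Lemma perm_adj_ind n (P : 'S_n.+1 -> Prop) :
  P 1%g -> (forall s i, i < n -> P s -> P (s * adj_tperm n i)%g) -> forall s, P s.
Proof.
elim: n P => [|n IH] P P1 PM s.
  suff -> : s = 1%g by [].
  by apply/permP => k; rewrite perm1 [k]ord1 [s _]ord1.
have P0 u : P (lift_perm ord0 ord0 u).
  elim/IH: u => [|u i ltin Pu]; first by rewrite lift_perm1.
  by rewrite -(@lift_adj2 _ ord0 u i.+1 i) //; apply: PM.
rewrite -(perm_restK s); move: (s ord0) (perm_rest s) => j {}s.
case: j => j; elim: j => [|j IHj] ltj.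
  by have := P0 s; congr (P (lift_perm _ _ _)); apply: val_inj.
have ltj' : j < n.+2 by lia.
rewrite -(@lift_adj _ (Ordinal ltj') (Ordinal ltj) s j) //=; try lia.
  by apply: PM; [lia | exact: IHj].
by apply: val_inj; rewrite /= val_adj_tperm /= ?eqxx //; lia.
Qed.

Lemma insert0 n : insert X n 0 = idm _. Proof. by case: n. Qed.

Lemma sym_act1 n : sym_act (1%g : 'S_n) = idm (tp n).
Proof.
elim: n => //= n IH; rewrite perm1 insert0 c1m.
by rewrite -(lift_perm1 ord0) lift_permK IH t11.
Qed.

Lemma sym_act_tperm n i : i < n ->
  sym_act (adj_tperm n i) = adj_braid X n.+1 i.
Proof. by move=> ltin; rewrite -[adj_tperm n i]mul1g sym_act_adj // sym_act1 cm1. Qed.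

Lemma sym_actM n (s u : 'S_n) : sym_act (s * u)%g = sym_act u \oc sym_act s.
Proof.
case: n s u => [|n] s u; first by rewrite /= cm1.
elim/perm_adj_ind: u => [|u i ltin IH]; first by rewrite mulg1 sym_act1 c1m.
by rewrite mulgA !sym_act_adj // IH cA.
Qed.

Local Close Scope nat_scope.

(* The idempotent e_n, where r is the inverse of n! (see antisymP). *)
Definition antisym n (r : K) : hom (tp n) (tp n) :=
  r *: \sum_(s : 'S_n) (-1) ^+ odd_perm s *: sym_act s.

Lemma antisymP n (r : K) (hr : (n`!)%:R * r = 1) :
  antisym n r \oc antisym n r = antisym n r.
Proof.
have E s : sym_act s \oc antisym n r = (-1) ^+ odd_perm s *: antisym n r.
  rewrite /antisym compZr comp_sumr scalerA mulrC -scalerA; congr (r *: _).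
  rewrite scaler_sumr [RHS](reindex_inj (mulIg s)) /=; apply: eq_bigr => u _.
  rewrite compZr -sym_actM scalerA odd_permM signr_addb; congr (_ *: _).
  by rewrite [X in _ = _ * X]mulrC mulrA -expr2 sqrr_sign mul1r.
rewrite {1}/antisym compZl comp_suml.
under eq_bigr => s _ do rewrite compZl E scalerA -expr2 sqrr_sign scale1r.
by rewrite sumr_const -scaler_nat card_Sn scalerA mulrC hr scale1r.
Qed.

End SymAct.

Section Karoubi.
Variables (K : comPzRingType) (C : sym_mon_cat K).
Let L := smcP C.

(* The idempotent completion: (X, e) stands for the image of e, and a morphism
   (X, e) -> (Y, e') is an f : X -> Y with e' f e = f. *)
Record summand := Summand {
  sm_obj : C;
  sm_idem : hom sm_obj sm_obj;
  sm_idemP : sm_idem \oc sm_idem = sm_idem }.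


Definition sm_hom_pred (P Q : summand) : {pred hom (sm_obj P) (sm_obj Q)} :=
  fun f => sm_idem Q \oc f \oc sm_idem P == f.

Arguments sm_hom_pred : clear implicits.

Lemma sm_hom_submod P Q : submod_closed (sm_hom_pred P Q).
Proof.
split=> [|a u v]; rewrite ?inE /sm_hom_pred !unfold_in; first by rewrite comp0r comp0l.
move=> /eqP Eu /eqP Ev; apply/eqP.
by rewrite compDr compZr compDl compZl Eu Ev.
Qed.
HB.instance Definition _ P Q :=
  GRing.isSubmodClosed.Build K _ (sm_hom_pred P Q) (@sm_hom_submod P Q).

Record sm_hom (P Q : summand) := SmHom {
  sm_val : hom (sm_obj P) (sm_obj Q);
  sm_valP : sm_val \in sm_hom_pred P Q }.

HB.instance Definition _ P Q := [isSub for @sm_val P Q].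
HB.instance Definition _ P Q := [Choice of sm_hom P Q by <:].
HB.instance Definition _ P Q := [SubChoice_isSubLmodule of sm_hom P Q by <:].

Implicit Types P Q R S : summand.

Lemma sm_homE P Q (f : sm_hom P Q) : sm_idem Q \oc sm_val f \oc sm_idem P = sm_val f.
Proof. by have /eqP := sm_valP f. Qed.
Lemma sm_homl P Q (f : sm_hom P Q) : sm_idem Q \oc sm_val f = sm_val f.
Proof. by rewrite -sm_homE !cA sm_idemP. Qed.
Lemma sm_homr P Q (f : sm_hom P Q) : sm_val f \oc sm_idem P = sm_val f.
Proof. by rewrite -sm_homE -!cA sm_idemP. Qed.

Fact sm_cut_subproof P Q (f : hom (sm_obj P) (sm_obj Q)) :
  sm_idem Q \oc f \oc sm_idem P \in sm_hom_pred P Q.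
Proof.
by rewrite unfold_in /sm_hom_pred -!cA sm_idemP !cA sm_idemP.
Qed.
Definition sm_cut P Q (f : hom (sm_obj P) (sm_obj Q)) : sm_hom P Q :=
  SmHom (sm_cut_subproof f).

Fact sm_tens_subproof P Q : (sm_idem P \om sm_idem Q) \oc (sm_idem P \om sm_idem Q) = sm_idem P \om sm_idem Q.
Proof. by rewrite tc !sm_idemP. Qed.
Definition sm_tens P Q := Summand (sm_tens_subproof P Q).

Definition sm_unit := Summand (cm1 (idm (@unit_obj K C))).

Definition karoubi_data : smc_data K := {|
  obj := summand;
  hom := fun P Q => sm_hom P Q;
  idm := fun P => @sm_cut P P (idm _);
  comp := fun P Q R g f => sm_cut (sm_val g \oc sm_val f);
  unit_obj := sm_unit;
  tens := sm_tens;
  tensm := fun P P' Q Q' f g =>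
    @sm_cut (sm_tens P Q) (sm_tens P' Q') (sm_val f \om sm_val g);
  assoc := fun P Q R =>
    @sm_cut (sm_tens (sm_tens P Q) R) (sm_tens P (sm_tens Q R)) (assoc _ _ _);
  associ := fun P Q R =>
    @sm_cut (sm_tens P (sm_tens Q R)) (sm_tens (sm_tens P Q) R) (associ _ _ _);
  lunit := fun P => @sm_cut (sm_tens sm_unit P) P (lunit _);
  luniti := fun P => @sm_cut P (sm_tens sm_unit P) (luniti _);
  runit := fun P => @sm_cut (sm_tens P sm_unit) P (runit _);
  runiti := fun P => @sm_cut P (sm_tens P sm_unit) (runiti _);
  braid := fun P Q => @sm_cut (sm_tens P Q) (sm_tens Q P) (braid _ _) |}.

Lemma sm_cutE P Q (f : hom (sm_obj P) (sm_obj Q)) :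
  sm_idem Q \oc f = f \oc sm_idem P -> sm_val (sm_cut f) = f \oc sm_idem P.
Proof. by move=> /= ->; rewrite -cA sm_idemP. Qed.

Local Notation D := karoubi_data.

Lemma kidE P : sm_val (idm (P : D)) = sm_idem P.
Proof. by rewrite /= cm1 sm_idemP. Qed.
Lemma kcE P Q R (g : hom (Q : D) R) (f : hom (P : D) Q) :
  sm_val (g \oc f) = sm_val g \oc sm_val f.
Proof. by rewrite /= cA sm_homl -cA sm_homr. Qed.
Lemma ktE P P' Q Q' (f : hom (P : D) P') (g : hom (Q : D) Q') :
  sm_val (f \om g) = sm_val f \om sm_val g.
Proof. by rewrite /= !tc !sm_homl !sm_homr. Qed.
Lemma kaE P Q R : sm_val (assoc (P : D) Q R)
  = assoc _ _ _ \oc ((sm_idem P \om sm_idem Q) \om sm_idem R).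
Proof. by apply: sm_cutE; rewrite /= (assoc_nat L). Qed.
Lemma kaiE P Q R : sm_val (associ (P : D) Q R)
  = associ _ _ _ \oc (sm_idem P \om (sm_idem Q \om sm_idem R)).
Proof. by apply: sm_cutE; rewrite /= associ_nat. Qed.
Lemma luniti_nat (X Y : C) (f : hom X Y) :
  luniti Y \oc f = (idm unit_obj \om f) \oc luniti X.
Proof.
rewrite -[LHS]cm1 -(lunitiK L) cA -(cA (luniti _)) -(lunit_nat L).
by rewrite !cA (lunitK L) c1m.
Qed.
Lemma runiti_nat (X Y : C) (f : hom X Y) :
  runiti Y \oc f = (f \om idm unit_obj) \oc runiti X.
Proof.
rewrite -[LHS]cm1 -(runitiK L) cA -(cA (runiti _)) -(runit_nat L).
by rewrite !cA (runitK L) c1m.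
Qed.
Lemma klE P : sm_val (lunit (P : D)) = lunit _ \oc (idm _ \om sm_idem P).
Proof. by apply: sm_cutE; rewrite /= (lunit_nat L). Qed.
Lemma kliE P : sm_val (luniti (P : D)) = luniti _ \oc sm_idem P.
Proof. by apply: sm_cutE; rewrite /= luniti_nat. Qed.
Lemma krE P : sm_val (runit (P : D)) = runit _ \oc (sm_idem P \om idm _).
Proof. by apply: sm_cutE; rewrite /= (runit_nat L). Qed.
Lemma kriE P : sm_val (runiti (P : D)) = runiti _ \oc sm_idem P.
Proof. by apply: sm_cutE; rewrite /= runiti_nat. Qed.
Lemma kbE P Q : sm_val (braid (P : D) Q) = braid _ _ \oc (sm_idem P \om sm_idem Q).
Proof. by apply: sm_cutE; rewrite /= (braid_nat L). Qed.
Lemma ktoE P Q : sm_idem ((P : D) \ox Q) = sm_idem P \om sm_idem Q.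
Proof. by []. Qed.
Lemma kuE : sm_idem (unit_obj : D) = idm _.
Proof. by []. Qed.
Definition kE := (kcE, ktE, kidE, kaE, kaiE, klE, kliE, krE, kriE, kbE, ktoE, kuE).

Lemma sm_val_lin P Q (a : K) (f g : sm_hom P Q) :
  sm_val (a *: f + g) = a *: sm_val f + sm_val g.
Proof. by []. Qed.


Lemma tsl X X' Y Y' Y'' (p : hom X X') (a : hom Y' Y'') (b : hom Y Y') :
  p \om (a \oc b) = (idm X' \om a) \oc ((p \om b) : hom ((X : C) \ox Y) (X' \ox Y')).
Proof. by rewrite tc c1m. Qed.

Lemma tsr X X' Y Y' Y'' (p : hom X X') (a : hom Y' Y'') (b : hom Y Y') :
  (a \oc b) \om p = (a \om idm X') \oc ((b \om p) : hom ((Y : C) \ox X) (Y' \ox X')).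
Proof. by rewrite tc c1m. Qed.

Lemma idem_comp (X Y Z : C) (b : hom Y Z) (a : hom X Y) p q :
  q \oc a = a \oc p -> p \oc p = p -> b \oc q \oc (a \oc p) = b \oc a \oc p.
Proof. by move=> E pp; rewrite !cA -(cA b) E !cA -(cA _ p p) pp. Qed.

Lemma idem_inv (X Y : C) (b : hom Y X) (a : hom X Y) p q :
  q \oc a = a \oc p -> b \oc a = idm X -> p \oc p = p ->
  b \oc q \oc (a \oc p) = p.
Proof. by move=> E ba pp; rewrite idem_comp // ba c1m. Qed.

Lemma idem_nat (X X' Y Y' : C) (a : hom X Y) (a' : hom X' Y') f g p p' :
  a' \oc f = g \oc a -> p' \oc f = f -> f \oc p = f ->
  a' \oc p' \oc f = g \oc (a \oc p).
Proof. by move=> E p'f fp; rewrite -cA p'f cA -E -cA fp. Qed.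

Lemma idem_pentagon (X Y Z W : C) p q r s :
  p \oc p = p -> q \oc q = q -> r \oc r = r -> s \oc s = s ->
  p \om (assoc Y Z W \oc ((q \om r) \om s))
    \oc (assoc X (Y \ox Z) W \oc ((p \om (q \om r)) \om s))
    \oc ((assoc X Y Z \oc ((p \om q) \om r)) \om s)
  = assoc X Y (Z \ox W) \oc ((p \om q) \om (r \om s))
    \oc (assoc (X \ox Y) Z W \oc (((p \om q) \om r) \om s)).
Proof.
move=> pp qq rr ss; rewrite tsl tsr.
rewrite idem_comp; first last.
- by rewrite !tc pp qq rr ss.
- by rewrite (assoc_nat L).
rewrite idem_comp; first last.
- by rewrite !tc pp qq rr ss.
- by rewrite !tc (assoc_nat L) cm1 c1m.
rewrite idem_comp; first last.
- by rewrite !tc pp qq rr ss.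
- by rewrite (assoc_nat L).
by rewrite (pentagon L).
Qed.

Lemma idem_hexagon (X Y Z : C) p q r :
  p \oc p = p -> q \oc q = q -> r \oc r = r ->
  assoc Y Z X \oc ((q \om r) \om p)
    \oc (braid X (Y \ox Z) \oc (p \om (q \om r)))
    \oc (assoc X Y Z \oc ((p \om q) \om r))
  = (q \om (braid X Z \oc (p \om r)))
    \oc (assoc Y X Z \oc ((q \om p) \om r))
    \oc ((braid X Y \oc (p \om q)) \om r).
Proof.
move=> pp qq rr; rewrite tsl tsr.
rewrite idem_comp; first last.
- by rewrite !tc pp qq rr.
- by rewrite (braid_nat L).
rewrite idem_comp; first last.
- by rewrite !tc pp qq rr.
- by rewrite (assoc_nat L).
rewrite (@idem_comp _ _ _ (idm _ \om _)); first last.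
- by rewrite !tc pp qq rr.
- by rewrite (assoc_nat L).
rewrite [RHS]idem_comp; first last.
- by rewrite !tc pp qq rr.
- by rewrite !tc (braid_nat L) cm1 c1m.
by rewrite (hexagon L).
Qed.

Lemma karoubi_laws : smc_laws karoubi_data.
Proof.
split=> *; apply: val_inj; rewrite -?[LHS]/(sm_val _) -?[RHS]/(sm_val _).
- by rewrite !kE sm_homl.
- by rewrite !kE sm_homr.
- by rewrite !kE cA.
- by rewrite [RHS]sm_val_lin !kE sm_val_lin (comp_linearl L).
- by rewrite [RHS]sm_val_lin !kE sm_val_lin (comp_linearr L).
- by rewrite [RHS]sm_val_lin !kE sm_val_lin (tensm_linearl L).
- by rewrite [RHS]sm_val_lin !kE sm_val_lin (tensm_linearr L).
- by rewrite !kE.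
- by rewrite !kE tc.
all: rewrite !kE.
- by apply: idem_inv; rewrite ?(assocK L) ?(assoc_nat L) // !tc !sm_idemP.
- by apply: idem_inv; rewrite ?(associK L) ?associ_nat // !tc !sm_idemP.
- by apply: idem_inv; rewrite ?(lunitK L) ?(lunit_nat L) // tc sm_idemP cm1.
- by apply: idem_inv; rewrite ?(lunitiK L) ?luniti_nat // sm_idemP.
- by apply: idem_inv; rewrite ?(runitK L) ?(runit_nat L) // tc sm_idemP cm1.
- by apply: idem_inv; rewrite ?(runitiK L) ?runiti_nat // sm_idemP.
- by apply: idem_nat; rewrite ?(assoc_nat L) // !tc ?sm_homl ?sm_homr.
- by apply: idem_nat; rewrite ?(lunit_nat L) // tc ?sm_homl ?sm_homr cm1.
- by apply: idem_nat; rewrite ?(runit_nat L) // tc ?sm_homl ?sm_homr cm1.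
- by apply: idem_nat; rewrite ?(braid_nat L) // tc ?sm_homl ?sm_homr.
- by apply: idem_inv; rewrite ?(braidK L) ?(braid_nat L) // tc !sm_idemP.
- set p := sm_idem _; set q := sm_idem _.
  have pp : p \oc p = p by exact: sm_idemP.
  have qq : q \oc q = q by exact: sm_idemP.
  rewrite (lunit_nat L) (runit_nat L) (assoc_nat L) cA tc pp -cA (lunit_nat L) cA qq.
  transitivity ((p \om q) \oc (runit _ \om idm _)); last by rewrite tc cm1.
  by rewrite -(triangle L) cA tc cm1.
- by apply: idem_pentagon; exact: sm_idemP.
- by apply: idem_hexagon; exact: sm_idemP.
Qed.

Definition karoubi : sym_mon_cat K := SymMonCat karoubi_laws.

End Karoubi.

Section AdditiveEnvelope.
Variables (K : comPzRingType) (C : sym_mon_cat K).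
Let L := smcP C.

(* A finite family stands for the direct sum of its members; morphisms are
   matrices.  The empty family is allowed. *)
Record family := Family {
  fam_idx : finType;
  fam_obj :> fam_idx -> C }.

Implicit Types A B D E : family.

Definition fam_hom A B :=
  {dffun forall p : fam_idx A * fam_idx B, hom (A p.1) (B p.2)}.
HB.instance Definition _ A B := Choice.on (fam_hom A B).

Definition entry A B (f : fam_hom A B) i j : hom (A i) (B j) := f (i, j).

Definition mk_fam_hom A B (F : forall i j, hom (A i) (B j)) : fam_hom A B :=
  finfun (fun p => F p.1 p.2).

Lemma entry_mk A B (F : forall i j, hom (A i) (B j)) i j :
  entry (mk_fam_hom F) i j = F i j.
Proof. by rewrite /entry ffunE. Qed.

Lemma fam_homP A B (f g : fam_hom A B) :
  (forall i j, entry f i j = entry g i j) -> f = g.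
Proof. by move=> E; apply/ffunP => -[i j]; exact: E. Qed.

Definition fam_zero A B : fam_hom A B := mk_fam_hom (fun _ _ => 0).
Definition fam_opp A B (f : fam_hom A B) := mk_fam_hom (fun i j => - entry f i j).
Definition fam_add A B (f g : fam_hom A B) :=
  mk_fam_hom (fun i j => entry f i j + entry g i j).
Definition fam_scale A B (a : K) (f : fam_hom A B) :=
  mk_fam_hom (fun i j => a *: entry f i j).

Fact fam_addA A B : associative (@fam_add A B).
Proof. by move=> *; apply: fam_homP => *; rewrite !entry_mk addrA. Qed.
Fact fam_addC A B : commutative (@fam_add A B).
Proof. by move=> *; apply: fam_homP => *; rewrite !entry_mk addrC. Qed.
Fact fam_add0 A B : left_id (fam_zero A B) (@fam_add A B).
Proof. by move=> *; apply: fam_homP => *; rewrite !entry_mk add0r. Qed.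
Fact fam_addN A B : left_inverse (fam_zero A B) (@fam_opp A B) (@fam_add A B).
Proof. by move=> *; apply: fam_homP => *; rewrite !entry_mk addNr. Qed.
HB.instance Definition _ A B := GRing.isZmodule.Build (fam_hom A B)
  (@fam_addA A B) (@fam_addC A B) (@fam_add0 A B) (@fam_addN A B).

Fact fam_scaleA A B a b (f : fam_hom A B) :
  fam_scale a (fam_scale b f) = fam_scale (a * b) f.
Proof. by apply: fam_homP => *; rewrite !entry_mk scalerA. Qed.
Fact fam_scale1 A B : left_id 1 (@fam_scale A B).
Proof. by move=> *; apply: fam_homP => *; rewrite !entry_mk scale1r. Qed.
Fact fam_scaleDr A B : right_distributive (@fam_scale A B) +%R.
Proof. by move=> *; apply: fam_homP => *; rewrite !entry_mk scalerDr. Qed.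
Fact fam_scaleDl A B (f : fam_hom A B) :
  {morph (@fam_scale A B)^~ f : a b / a + b}.
Proof. by move=> *; apply: fam_homP => *; rewrite !entry_mk scalerDl. Qed.
HB.instance Definition _ A B := GRing.Zmodule_isLmodule.Build K (fam_hom A B)
  (@fam_scaleA A B) (@fam_scale1 A B) (@fam_scaleDr A B) (@fam_scaleDl A B).

Lemma entryD A B (f g : fam_hom A B) i j :
  entry (f + g) i j = entry f i j + entry g i j.
Proof. exact: entry_mk. Qed.
Lemma entryZ A B a (f : fam_hom A B) i j : entry (a *: f) i j = a *: entry f i j.
Proof. exact: entry_mk. Qed.

(* The matrix whose only nonzero entry in row i is phi i, in column h i. *)
Definition reindex A B (h : fam_idx A -> fam_idx B)
    (phi : forall i, hom (A i) (B (h i))) : fam_hom A B :=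
  mk_fam_hom (fun i j =>
    if h i =P j is ReflectT ij then ecast k (hom (A i) (B k)) ij (phi i) else 0).

Definition fam_comp A B D (g : fam_hom B D) (f : fam_hom A B) : fam_hom A D :=
  mk_fam_hom (fun i k => \sum_j entry g j k \oc entry f i j).

Definition fam_unit := @Family unit (fun=> unit_obj).

Definition fam_tens A B :=
  @Family (fam_idx A * fam_idx B)%type (fun p => A p.1 \ox B p.2).

Definition fam_tensm A A' B B' (f : fam_hom A A') (g : fam_hom B B') :
    fam_hom (fam_tens A B) (fam_tens A' B') :=
  @mk_fam_hom (fam_tens A B) (fam_tens A' B')
    (fun p q => entry f p.1 q.1 \om entry g p.2 q.2).

Definition additive_data : smc_data K := {|
  obj := family;
  hom := fun A B => fam_hom A B;
  idm := fun A => @reindex A A id (fun i => idm (A i));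
  comp := fam_comp;
  unit_obj := fam_unit;
  tens := fam_tens;
  tensm := fam_tensm;
  assoc := fun A B D =>
    @reindex (fam_tens (fam_tens A B) D) (fam_tens A (fam_tens B D))
      (fun p => (p.1.1, (p.1.2, p.2))) (fun p => assoc (A p.1.1) (B p.1.2) (D p.2));
  associ := fun A B D =>
    @reindex (fam_tens A (fam_tens B D)) (fam_tens (fam_tens A B) D)
      (fun p => ((p.1, p.2.1), p.2.2)) (fun p => associ (A p.1) (B p.2.1) (D p.2.2));
  lunit := fun A => @reindex (fam_tens fam_unit A) A snd (fun p => lunit (A p.2));
  luniti := fun A => @reindex A (fam_tens fam_unit A) (pair tt) (fun i => luniti (A i));
  runit := fun A => @reindex (fam_tens A fam_unit) A fst (fun p => runit (A p.1));
  runiti := fun A =>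
    @reindex A (fam_tens A fam_unit) (fun i => (i, tt)) (fun i => runiti (A i));
  braid := fun A B => @reindex (fam_tens A B) (fam_tens B A)
    (fun p => (p.2, p.1)) (fun p => braid (A p.1) (B p.2)) |}.

Local Notation M := additive_data.

Definition is_mono A B (f : fam_hom A B) (h : fam_idx A -> fam_idx B)
    (phi : forall i, hom (A i) (B (h i))) : Prop :=
  (forall i, entry f i (h i) = phi i) /\
  (forall i j, h i != j -> entry f i j = 0).

Lemma reindexP A B h phi : is_mono (@reindex A B h phi) phi.
Proof.
split=> [i|i j]; rewrite entry_mk; case: eqP => // E.
by rewrite eq_axiomK.
Qed.

Lemma entry_reindex A B h phi i : entry (@reindex A B h phi) i (h i) = phi i.
Proof. by case: (reindexP phi). Qed.

Lemma entry_reindex0 A B h phi i j : h i != j -> entry (@reindex A B h phi) i j = 0.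
Proof. by case: (reindexP phi) => _; apply. Qed.

Lemma is_mono_eq A B (f g : fam_hom A B) h phi psi :
  @is_mono A B f h phi -> @is_mono A B g h psi -> (forall i, phi i = psi i) ->
  f = g.
Proof.
move=> [f1 f0] [g1 g0] E; apply: fam_homP => i j.
by have [<-|ij] := eqVneq (h i) j; rewrite ?f1 ?g1 // f0 // g0.
Qed.

Lemma is_mono_id A (f : fam_hom A A) h phi :
  @is_mono A A f h phi -> (forall i, h i = i) ->
  (forall i, entry f i i = idm (A i)) -> f = idm (A : M).
Proof.
move=> [_ f0] hid f1; apply: fam_homP => i j.
have [<-|ij] := eqVneq i j; last by rewrite f0 ?hid // entry_reindex0.
by rewrite f1 [RHS](@entry_reindex A A id).
Qed.

Lemma comp_reindexr A B D (g : fam_hom B D) h phi i k :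
  entry (fam_comp g (@reindex A B h phi)) i k = entry g (h i) k \oc phi i.
Proof.
rewrite entry_mk (bigD1 (h i)) //= entry_reindex big1 ?addr0 // => j.
by rewrite eq_sym => ij; rewrite entry_reindex0 // comp0r.
Qed.

Lemma comp_reindexl A B D (f : fam_hom A B) h phi i j : injective h ->
  entry (fam_comp (@reindex B D h phi) f) i (h j) = phi j \oc entry f i j.
Proof.
move=> hI; rewrite entry_mk (bigD1 j) //= entry_reindex big1 ?addr0 // => l lj.
by rewrite entry_reindex0 ?comp0l // (inj_eq hI).
Qed.

Lemma is_mono_comp A B D (g : fam_hom B D) (f : fam_hom A B) h phi k psi :
  @is_mono B D g k psi -> @is_mono A B f h phi ->
  is_mono (fam_comp g f) (fun i => psi (h i) \oc phi i).
Proof.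
move=> [g1 g0] [f1 f0]; split=> [i|i j ij].
  rewrite entry_mk (bigD1 (h i)) //= f1 g1 big1 ?addr0 // => l.
  by rewrite eq_sym => il; rewrite f0 // comp0r.
rewrite entry_mk big1 // => l _.
have [<-|il] := eqVneq (h i) l; last by rewrite f0 // comp0r.
by rewrite g0 // comp0l.
Qed.

Lemma is_mono_tens A A' B B' (f : fam_hom A A') (g : fam_hom B B') h phi k psi :
  @is_mono A A' f h phi -> @is_mono B B' g k psi ->
  @is_mono (fam_tens A B) (fam_tens A' B')
    (fam_tensm f g)
    (fun p => (h p.1, k p.2)) (fun p => phi p.1 \om psi p.2).
Proof.
move=> [f1 f0] [g1 g0]; split=> [p|p q]; rewrite entry_mk /= ?f1 ?g1 //.
rewrite -pair_eqE /= /pair_eq /= negb_and => /orP[/f0|/g0] ->.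
  by rewrite tens0l.
by rewrite tens0r.
Qed.

Lemma entry_comp A B D (g : hom (B : M) D) (f : hom (A : M) B) i k :
  entry (g \oc f) i k = \sum_j entry g j k \oc entry f i j.
Proof. exact: entry_mk. Qed.

Lemma entry_tens A A' B B' (f : hom (A : M) A') (g : hom (B : M) B') p q :
  @entry (fam_tens A B) (fam_tens A' B') (f \om g) p q
  = entry f p.1 q.1 \om entry g p.2 q.2.
Proof. exact: (@entry_mk (fam_tens A B)). Qed.

Lemma entry_idm A i : entry (idm (A : M)) i i = idm (A i).
Proof. exact: (@entry_reindex A A id). Qed.

Lemma mono_idm A : @is_mono A A (idm (A : M)) id (fun i => idm (A i)).
Proof. exact: reindexP. Qed.

Lemma mono_assoc A B D :
  @is_mono (fam_tens (fam_tens A B) D) (fam_tens A (fam_tens B D))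
    (assoc (A : M) B D) (fun p => (p.1.1, (p.1.2, p.2)))
    (fun p => assoc (A p.1.1) (B p.1.2) (D p.2)).
Proof. exact: reindexP. Qed.

Lemma mono_lunit A : @is_mono (fam_tens fam_unit A) A (lunit (A : M)) snd
  (fun p => lunit (A p.2)).
Proof. exact: reindexP. Qed.

Lemma mono_runit A : @is_mono (fam_tens A fam_unit) A (runit (A : M)) fst
  (fun p => runit (A p.1)).
Proof. exact: reindexP. Qed.

Lemma mono_braid A B : @is_mono (fam_tens A B) (fam_tens B A)
  (braid (A : M) B) (fun p => (p.2, p.1)) (fun p => braid (A p.1) (B p.2)).
Proof. exact: reindexP. Qed.

Lemma additive_laws : smc_laws additive_data.
Proof.
split.
- move=> A B f; apply: fam_homP => i j.
  by rewrite [LHS](@comp_reindexl A B B f id) ?c1m //; exact: inj_id.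
- move=> A B f; apply: fam_homP => i j.
  by rewrite [LHS](@comp_reindexr A A B f id) cm1.
- move=> A B D E h g f; apply: fam_homP => i l; rewrite !entry_comp.
  under eq_bigr => k _ do rewrite entry_comp comp_sumr.
  rewrite exchange_big; apply: eq_bigr => j _ /=.
  by rewrite entry_comp comp_suml; apply: eq_bigr => k _; rewrite cA.
- move=> A B D f a g g'; apply: fam_homP => i k.
  rewrite entryD entryZ !entry_comp scaler_sumr -big_split; apply: eq_bigr => j _ /=.
  by rewrite entryD entryZ (comp_linearl L).
- move=> A B D g a f f'; apply: fam_homP => i k.
  rewrite entryD entryZ !entry_comp scaler_sumr -big_split; apply: eq_bigr => j _ /=.
  by rewrite entryD entryZ (comp_linearr L).
- move=> A A' B B' g a f f'; apply: fam_homP => p q.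
  by rewrite [RHS]entryD entryZ !entry_tens entryD entryZ (tensm_linearl L).
- move=> A A' B B' f a g g'; apply: fam_homP => p q.
  by rewrite [RHS]entryD entryZ !entry_tens entryD entryZ (tensm_linearr L).
- move=> A B; apply: (@is_mono_id (fam_tens A B)).
  + by apply: is_mono_tens; apply: reindexP.
  + by case.
  + by move=> p; rewrite entry_tens !entry_idm t11.
- move=> A A' A'' B B' B'' f' f g' g; apply: fam_homP => p q.
  rewrite [LHS]entry_tens !entry_comp.
  rewrite tens_suml; under eq_bigr => i _ do rewrite tens_sumr.
  rewrite pair_big; apply: eq_bigr => -[i j] _ /=.
  by rewrite !entry_tens tc.
- move=> A B D; apply: is_mono_id.
  + by apply: is_mono_comp; apply: reindexP.
  + by case=> [[]].
  + case=> [[a b] d].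
    by rewrite [LHS](is_mono_comp (reindexP _) (reindexP _)).1 (assocK L).
- move=> A B D; apply: is_mono_id.
  + by apply: is_mono_comp; apply: reindexP.
  + by case=> [a []].
  + case=> [a [b d]].
    by rewrite [LHS](is_mono_comp (reindexP _) (reindexP _)).1 (associK L).
- move=> A; apply: is_mono_id.
  + by apply: is_mono_comp; apply: reindexP.
  + by case=> [[]].
  + case=> [[] a].
    by rewrite [LHS](is_mono_comp (reindexP _) (reindexP _)).1 (lunitK L).
- move=> A; apply: is_mono_id.
  + by apply: is_mono_comp; apply: reindexP.
  + by [].
  + move=> a.
    by rewrite [LHS](is_mono_comp (reindexP _) (reindexP _)).1 (lunitiK L).
- move=> A; apply: is_mono_id.
  + by apply: is_mono_comp; apply: reindexP.
  + by case=> [? []].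
  + case=> [a []].
    by rewrite [LHS](is_mono_comp (reindexP _) (reindexP _)).1 (runitK L).
- move=> A; apply: is_mono_id.
  + by apply: is_mono_comp; apply: reindexP.
  + by [].
  + move=> a.
    by rewrite [LHS](is_mono_comp (reindexP _) (reindexP _)).1 (runitiK L).
- move=> A A' B B' D D' f g h; apply: fam_homP => p [a [b d]].
  rewrite [LHS](@comp_reindexl _ (fam_tens (fam_tens A' B') D') _ _ _ _ p ((a, b), d)); last first.
    by move=> [[? ?] ?] [[? ?] ?] /= [-> -> ->].
  by rewrite [RHS]comp_reindexr !entry_tens /= (assoc_nat L).
- move=> A A' f; apply: fam_homP => -[[] a] a'.
  rewrite [LHS](@comp_reindexl (fam_tens fam_unit A) (fam_tens fam_unit A') _ _ _ _ (tt, a) (tt, a')); last first.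
    by move=> [[] ?] [[] ?] /= ->.
  by rewrite [RHS]comp_reindexr entry_tens entry_idm /= (lunit_nat L).
- move=> A A' f; apply: fam_homP => -[a []] a'.
  rewrite [LHS](@comp_reindexl (fam_tens A fam_unit) (fam_tens A' fam_unit) _ _ _ _ (a, tt) (a', tt)); last first.
    by move=> [? []] [? []] /= ->.
  by rewrite [RHS]comp_reindexr entry_tens entry_idm /= (runit_nat L).
- move=> A A' B B' f g; apply: fam_homP => p [b a].
  rewrite [LHS](@comp_reindexl _ (fam_tens A' B') _ _ _ _ p (a, b)); last first.
    by move=> [? ?] [? ?] /= [-> ->].
  by rewrite [RHS]comp_reindexr !entry_tens /= (braid_nat L).
- move=> A B; apply: is_mono_id.
  + by apply: is_mono_comp; apply: reindexP.
  + by case.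
  + case=> [a b].
    by rewrite [LHS](is_mono_comp (reindexP _) (reindexP _)).1 (braidK L).
- move=> A B.
  have H1 := is_mono_comp (is_mono_tens (mono_idm A) (mono_lunit B))
    (mono_assoc A fam_unit B).
  have H2 := is_mono_tens (mono_runit A) (mono_idm B).
  apply: (is_mono_eq H1 H2) => p; exact: triangle.
- move=> A B D E.
  have H1 := is_mono_comp (is_mono_comp
    (is_mono_tens (mono_idm A) (mono_assoc B D E)) (mono_assoc A (fam_tens B D) E))
    (is_mono_tens (mono_assoc A B D) (mono_idm E)).
  have H2 := is_mono_comp (mono_assoc A B (fam_tens D E))
    (mono_assoc (fam_tens A B) D E).
  apply: (is_mono_eq H1 H2) => p; exact: pentagon.
- move=> A B D.
  have H1 := is_mono_comp (is_mono_comp (mono_assoc B D A)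
    (mono_braid A (fam_tens B D))) (mono_assoc A B D).
  have H2 := is_mono_comp (is_mono_comp
    (is_mono_tens (mono_idm B) (mono_braid A D)) (mono_assoc B A D))
    (is_mono_tens (mono_braid A B) (mono_idm D)).
  apply: (is_mono_eq H1 H2) => p; exact: hexagon.
Qed.

Definition additive_envelope : sym_mon_cat K := SymMonCat additive_laws.

End AdditiveEnvelope.

Section Completion.
Variables (K : comPzRingType) (C : sym_mon_cat K).

(* Formal finite direct sums are adjoined first, then direct summands. *)
Definition completion : sym_mon_cat K := karoubi (additive_envelope C).

Definition fam_single (X : C) : additive_envelope C := @Family K C unit (fun=> X).

Definition fam_single_hom (X Y : C) (f : hom X Y) :
    hom (fam_single X) (fam_single Y) :=
  @mk_fam_hom K C (fam_single X) (fam_single Y) (fun _ _ => f).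

Lemma fam_single_comp (X Y Z : C) (g : hom Y Z) (f : hom X Y) :
  fam_single_hom (g \oc f) = fam_single_hom g \oc fam_single_hom f.
Proof.
apply: fam_homP => i k.
by rewrite entry_comp !entry_mk (big_pred1 tt) ?entry_mk //; case.
Qed.

Definition to_completion (X : C) : completion := Summand (cm1 (idm (fam_single X))).

Fact extpow_subproof (X : C) n (r : K) (hr : (n`!)%:R * r = 1) :
  fam_single_hom (antisym X n r) \oc fam_single_hom (antisym X n r)
  = fam_single_hom (antisym X n r).
Proof. by rewrite -fam_single_comp antisymP. Qed.

(* The object (tpow X n, e_n) of the completion. *)
Definition extpow (X : C) n (r : K) (hr : (n`!)%:R * r = 1) : completion :=
  Summand (extpow_subproof X hr).

End Completion.

(* Main.v *)
(* Let a be the antisymmetrizer of X^n, L = (X^n, a) its image and z the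
   endomorphism (1 (x) a) s (1 (x) a) of X (x) L, where s exchanges the first two
   factors of X (x) X^n.  A computation in the group algebra gives
   n z^2 + (n - 1) z = 1, so z is invertible.  In z the factor X of the source
   ends up inside the target L, and the factor X of the target comes out of the
   source L; when L is invertible, z therefore corresponds to an endomorphism of X
   of the form (X (x) ev) (co (x) X) with co : 1 -> X (x) Y and ev : Y (x) X -> 1.
   Composing with the inverse of z, one finds co and ev such that this zigzag is
   the identity of X.  The other zigzag is then an idempotent of Y, and its image
   in the Karoubi envelope is a dual of X. *)

Require Import Defs.
From mathcomp Require Import all_boot all_fingroup all_algebra.
(* MathComp's [vector.hom] must not shadow the categorical [hom]. *)
Import Defs.
Import GRing.Theory.

Set Implicit Arguments.
Unset Strict Implicit.
Unset Printing Implicit Defensive.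
Local Open Scope ring_scope.
Local Open Scope cat_scope.

(** * Signs and scalars under composition and tensor product *)

Section Linearity.
Variables (K : comPzRingType) (C : sym_mon_cat K).
Implicit Types A B D : C.

Lemma comp_opprl A B D (f : hom A B) (g : hom B D) : (- g) \oc f = - (g \oc f).
Proof. by rewrite -scaleN1r compZl scaleN1r. Qed.

Lemma comp_opprr A B D (f : hom A B) (g : hom B D) : g \oc (- f) = - (g \oc f).
Proof. by rewrite -scaleN1r compZr scaleN1r. Qed.

Lemma tens_scaler A A' B B' (f : hom A A') (g : hom B B') (a : K) :
  f \om (a *: g) = a *: (f \om g).
Proof. by rewrite -[a *: g]addr0 (tensm_linearr (smcP C)) tens0r addr0. Qed.

Lemma tens_opprr A A' B B' (f : hom A A') (g : hom B B') :
  f \om (- g) = - (f \om g).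
Proof. by rewrite -scaleN1r tens_scaler scaleN1r. Qed.

End Linearity.

(** * The quadratic relation for z *)

Section AntisymSwap.
Variables (K : comPzRingType) (C : sym_mon_cat K) (X : C).

Lemma sym_act_antisym n (r : K) (s : 'S_n) :
  sym_act X s \oc antisym X n r = (-1) ^+ odd_perm s *: antisym X n r.
Proof.
rewrite /antisym compZr comp_sumr scalerA mulrC -scalerA; congr (r *: _).
rewrite scaler_sumr [RHS](reindex_inj (mulIg s)) /=; apply: eq_bigr => u _.
rewrite compZr -sym_actM scalerA odd_permM signr_addb; congr (_ *: _).
by rewrite [X in _ = _ * X]mulrC mulrA -expr2 sqrr_sign mul1r.
Qed.

Lemma antisym_sym_act n (r : K) (s : 'S_n) :
  antisym X n r \oc sym_act X s = (-1) ^+ odd_perm s *: antisym X n r.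
Proof.
rewrite /antisym compZl comp_suml scalerA mulrC -scalerA; congr (r *: _).
rewrite scaler_sumr [RHS](reindex_inj (mulgI s)) /=; apply: eq_bigr => u _.
rewrite compZl -sym_actM scalerA odd_permM signr_addb; congr (_ *: _).
by rewrite mulrA -expr2 sqrr_sign mul1r.
Qed.

Lemma odd_adj_tperm n i : (i < n)%N -> odd_perm (adj_tperm n i) = true.
Proof.
move=> ltin; rewrite odd_tperm -val_eqE /= !inordK ?ltnS //; last exact: ltnW.
by rewrite ltn_eqF.
Qed.

Lemma adj_braid_antisym n (r : K) i : (i < n)%N ->
  adj_braid X n.+1 i \oc antisym X n.+1 r = - antisym X n.+1 r.
Proof.
by move=> ltin; rewrite -sym_act_tperm // sym_act_antisym odd_adj_tperm // scaleN1r.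
Qed.

Lemma antisym_adj_braid n (r : K) i : (i < n)%N ->
  antisym X n.+1 r \oc adj_braid X n.+1 i = - antisym X n.+1 r.
Proof.
by move=> ltin; rewrite -sym_act_tperm // antisym_sym_act odd_adj_tperm // scaleN1r.
Qed.

(** On X (x) X^(m+1), z becomes [e s e]; up to sign and the factor [r], [sandwich] is the term of
    one permutation in z^2 = [e s e s e]. *)
Local Notation e m r := (idm X \om antisym X m.+1 r).
Local Notation s m := (swap X X (tpow X m)).
Local Notation sandwich m r g := (e m r \oc s m \oc (idm X \om g) \oc s m \oc e m r).

(** For [j = 0] the braid relation turns [s t s] into [t s t], t being the next transposition, and
    each outer t is absorbed by [e] with a sign. Each further adjacent transposition avoids the
    first two factors of X^(m+1), so it slides past [s] into [e] and costs one sign. *)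
Lemma sandwich_insertS m (r : K) j : (j < m)%N ->
  sandwich m r (insert X m j.+1) = (-1) ^+ j *: (e m r \oc s m \oc e m r).
Proof.
case: m => // p; elim: j => [|j IH] ltjp.
  rewrite scale1r /= insert0 t11 c1m.
  have E1 : (idm X \om s p) \oc e p.+1 r = - e p.+1 r.
    by rewrite -t1c1 (@adj_braid_antisym p.+1 r 0) // tens_opprr.
  have E2 : e p.+1 r \oc (idm X \om s p) = - e p.+1 r.
    by rewrite -t1c1 (@antisym_adj_braid p.+1 r 0) // tens_opprr.
  transitivity (e p.+1 r \oc (s p.+1 \oc (idm X \om s p) \oc s p.+1) \oc e p.+1 r).
    by rewrite !cA.
  by rewrite -swap_braid !cA E2 -(cA _ _ (e _ _)) E1 comp_opprr !comp_opprl opprK.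
rewrite -insertS // exprS -scalerA scaleN1r -IH; last exact: ltnW.
transitivity (e p.+1 r \oc (s p.+1 \oc (idm X \om (idm X \om adj_braid X p.+1 j)))
    \oc (idm X \om insert X p.+1 j.+1) \oc s p.+1 \oc e p.+1 r).
  by rewrite t1c1 !cA.
rewrite swap_nat (cA (e _ _)) -t1c1.
rewrite (_ : antisym X p.+2 r \oc _ = - antisym X p.+2 r) ?tens_opprr ?comp_opprl //.
exact: (@antisym_adj_braid p.+1 r j.+1).
Qed.

Lemma sandwich_insert m (r : K) j : (m.+1`!)%:R * r = 1 -> (j <= m)%N ->
  (-1) ^+ j *: sandwich m r (insert X m j)
  = if j == 0%N then e m r else - (e m r \oc s m \oc e m r).
Proof.
move=> hr; case: j => [|j] ltjm.
  by rewrite /= scale1r insert0 t11 cm1 -(cA (e _ _)) swapK cm1 -t1c1 (antisymP X hr).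
rewrite (sandwich_insertS r ltjm) exprS mulN1r scaleNr scalerA -expr2 sqrr_sign.
by rewrite scale1r.
Qed.

(** The part [u] acts beyond the factors exchanged by [s], so it commutes with [s] and [e] absorbs
    it with its sign; only [j] matters. *)
Lemma sandwich_sym_act m (r : K) (j : 'I_m.+1) (u : 'S_m) : (m.+1`!)%:R * r = 1 ->
  (-1) ^+ odd_perm (lift_perm ord0 j u)
    *: sandwich m r (sym_act X (lift_perm ord0 j u))
  = if j == ord0 then e m r else - (e m r \oc s m \oc e m r).
Proof.
move=> hr.
rewrite -[j == _]val_eqE [val ord0]/= -sandwich_insert //; last by rewrite -ltnS ltn_ord.
rewrite sym_act_lift odd_lift_perm [odd (@ord0 m)]/= addFb signr_addb signr_odd.
rewrite -scalerA; congr (_ *: _).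
suff -> : sandwich m r (insert X m j \oc (idm X \om sym_act X u))
    = (-1) ^+ odd_perm u *: sandwich m r (insert X m j).
  by rewrite scalerA -expr2 sqrr_sign scale1r.
transitivity (e m r \oc s m \oc (idm X \om insert X m j)
    \oc ((idm X \om (idm X \om sym_act X u)) \oc s m \oc e m r)).
  by rewrite t1c1 !cA.
rewrite -swap_nat -(cA (s m)) -t1c1.
have -> : (idm X \om sym_act X u) \oc antisym X m.+1 r
    = (-1) ^+ odd_perm u *: antisym X m.+1 r.
  have := sym_act_antisym r (lift_perm ord0 ord0 u).
  by rewrite sym_act_lift insert0 c1m odd_lift_perm.
by rewrite (tens_scaler _ _ ((-1) ^+ odd_perm u)) !(compZr _ ((-1) ^+ odd_perm u)) !cA.
Qed.

Lemma comp_tens_antisym n (r : K) Y Z (b : hom (X \ox tpow X n) Z)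
    (c : hom Y (X \ox tpow X n)) :
  b \oc (idm X \om antisym X n r) \oc c
  = r *: \sum_(w : 'S_n)
      (-1) ^+ odd_perm w *: (b \oc (idm X \om sym_act X w) \oc c).
Proof.
rewrite /antisym tens_scaler tens_sumr compZr compZl comp_sumr comp_suml.
by congr (r *: _); apply: eq_bigr => w _; rewrite tens_scaler compZr compZl.
Qed.

Lemma antisym_swap m (r : K) : (m.+1`!)%:R * r = 1 ->
  m.+1%:R *: (e m r \oc s m \oc e m r \oc s m \oc e m r)
    + m%:R *: (e m r \oc s m \oc e m r) = e m r.
Proof.
move=> hr.
have -> : e m r \oc s m \oc e m r \oc s m \oc e m r
    = r *: (m`!%:R *: (e m r - m%:R *: (e m r \oc s m \oc e m r))).
  transitivity (r *: \sum_(w : 'S_m.+1)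
      (-1) ^+ odd_perm w *: sandwich m r (sym_act X w)).
    rewrite -(cA _ (s m)) (@comp_tens_antisym m.+1); congr (r *: _).
    by apply: eq_bigr => w _; rewrite -(cA _ (s m) (e m r)).
  congr (r *: _).
  (* A permutation is its value [j] at 0 plus a permutation of the remaining m points. Each [j]
     contributes m! equal terms: [e] for [j = 0], [- e s e] for the m others. *)
  rewrite (bigop.reindex (fun p : 'I_m.+1 * 'S_m => lift_perm ord0 p.1 p.2)) /=; last first.
    exists (fun w : 'S_m.+1 => (w ord0, perm_rest w)) => [[j u] _|w _] /=.
      by rewrite lift_perm_id lift_permK.
    exact: perm_restK.
  rewrite (eq_bigr _ (fun p _ => sandwich_sym_act p.1 p.2 hr)).
  rewrite -(pair_bigA _ (fun (j : 'I_m.+1) (_ : 'S_m) =>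
     if j == ord0 then e m r else - (e m r \oc s m \oc e m r))) /=.
  under eq_bigr => j _ do rewrite sumr_const card_Sn.
  rewrite sumrMnl big_ord_recl /= scaler_nat; congr ((_ + _) *+ _).
  by rewrite sumr_const card_ord scaler_nat mulNrn.
rewrite !scalerA mulrAC -natrM -factS hr scale1r.
by rewrite -addrA addNr addr0.
Qed.

End AntisymSwap.

(** * Zigzags, and the passage from z to a zigzag when Z is invertible *)

Section Nuclear.
Variables (K : comPzRingType) (C : sym_mon_cat K).
Implicit Types X Y Z W : C.
Let L := smcP C.

Definition zigzag X Y (co : hom unit_obj (X \ox Y)) (ev : hom (Y \ox X) unit_obj) :
    hom X X :=
  runit X \oc (idm X \om ev) \oc assoc X Y X \oc (co \om idm X) \oc luniti X.

(** The source and target may differ, so that naturality in each can be stated separately. *)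
Definition zigzag_dual X Y Z (co : hom unit_obj (X \ox Z))
    (ev : hom (Y \ox X) unit_obj) : hom Y Z :=
  lunit Z \oc (ev \om idm Z) \oc associ Y X Z \oc (idm Y \om co) \oc runiti Y.

(** The incoming strand X ends in [ev], which can therefore absorb [f]. *)
Lemma zigzag_comp X Y (co : hom unit_obj (X \ox Y)) (ev : hom (Y \ox X) unit_obj)
    (f : hom X X) :
  zigzag co ev \oc f = zigzag co (ev \oc (idm Y \om f)).
Proof.
rewrite /zigzag -(cA _ (luniti X)) luniti_nat !cA -(cA _ (co \om _)) tc cm1 c1m.
rewrite -[in LHS](c1m co) -[in LHS](cm1 f) -[in LHS]tc !cA -(t11 X Y).
by rewrite -(cA _ (assoc _ _ _)) (assoc_nat L) !cA -(cA _ (idm X \om ev)) -t1c1.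
Qed.

Lemma swap_assocr X Y Z W :
  swap X Y (Z \ox W) \oc (idm X \om assoc Y Z W) \oc assoc X (Y \ox Z) W
  = (idm Y \om assoc X Z W) \oc assoc Y (X \ox Z) W \oc (swap X Y Z \om idm W).
Proof.
move: (@swap K C) (@swap_assoc K C) => sw swA; apply: epi_assoc1.
transitivity (sw X Y (Z \ox W) \oc ((idm X \om assoc Y Z W) \oc
    assoc X (Y \ox Z) W \oc (assoc X Y Z \om idm W))); first by rewrite !cA.
rewrite (pentagon L) cA swA -cA -t11 -(assoc_nat L) cA -(pentagon L).
by rewrite -!cA -!tc11 swA.
Qed.

(** Moving X past Y and W and then back past W leaves only the crossing with Y: the hexagon and
    symmetry. *)
Lemma swap_braid_assoc X Y W :
  (idm Y \om braid W X) \oc assoc Y W X \oc braid X (Y \ox W) = swap X Y W.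
Proof.
apply: epi_assoc; rewrite swap_assoc -!cA (cA _ _ (assoc X Y W)) (hexagon L) !cA.
by rewrite tc (braidK L) cm1 t11 c1m.
Qed.

(* [g] viewed as an endomorphism of X through X ~ X (x) (Z (x) Z'). *)
Definition cancel_tens X Z Z' (eps : hom (Z \ox Z') unit_obj)
    (eta : hom unit_obj (Z \ox Z')) (g : hom (X \ox Z) (X \ox Z)) : hom X X :=
  runit X \oc (idm X \om eps) \oc assoc X Z Z' \oc (g \om idm Z')
    \oc associ X Z Z' \oc (idm X \om eta) \oc runiti X.

Section CancelTens.
Variables (X Z Z' : C) (eps : hom (Z \ox Z') unit_obj) (eta : hom unit_obj (Z \ox Z')).
Hypotheses (eps_eta : eps \oc eta = idm unit_obj)
  (eta_eps : eta \oc eps = idm (Z \ox Z')).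

Lemma cancel_tens1 : cancel_tens eps eta (idm (X \ox Z)) = idm X.
Proof.
rewrite /cancel_tens t11 cm1 -(cA _ (assoc _ _ _)) (associK L) cm1.
by rewrite -(cA _ (idm X \om eps)) -t1c1 eps_eta t11 cm1 (runitiK L).
Qed.

Lemma cancel_tens_comp (g f : hom (X \ox Z) (X \ox Z)) :
  cancel_tens eps eta (g \oc f) = cancel_tens eps eta g \oc cancel_tens eps eta f.
Proof.
rewrite /cancel_tens !cA -(cA _ (runiti X)) (runitK L) cm1.
rewrite -(cA _ (idm X \om eta) (idm X \om eps)) -t1c1 eta_eps t11 cm1.
by rewrite -(cA _ (associ X Z Z') (assoc X Z Z')) (assocK L) cm1 tc11 !cA.
Qed.

Variables (Y : C) (u : hom Z (X \ox Y)) (v : hom (X \ox Y) Z).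

(* By coherence the last factor is the identity of X; keeping it avoids that proof. *)
Lemma cancel_tens_zigzag :
  cancel_tens eps eta ((idm X \om v) \oc swap X X Y \oc (idm X \om u))
  = zigzag (assoc X Y Z' \oc (u \om idm Z') \oc eta)
      (eps \oc (v \om idm Z') \oc associ X Y Z' \oc braid (Y \ox Z') X)
    \oc (lunit X \oc braid X unit_obj \oc runiti X).
Proof.
set co := _ \oc eta; set ev := _ \oc braid _ _.
(* Naturality carries the braiding with the unit across [co]; together with the braiding inside [ev]
   it forms a single [swap]. *)
have -> : zigzag co ev \oc (lunit X \oc braid X unit_obj \oc runiti X)
    = runit X \oc (idm X \om (eps \oc (v \om idm Z') \oc associ X Y Z'))
        \oc swap X X (Y \ox Z') \oc (idm X \om co) \oc runiti X.
  rewrite /zigzag -(cA _ (luniti X)) (cA (luniti X)) (cA (luniti X)) (lunitK L) c1m.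
  rewrite cA -(cA _ (co \om _)) -(braid_nat L) -swap_braid_assoc /ev.
  by rewrite (t1c1 _ _ (braid _ _)) !cA.
have S : swap X X (Y \ox Z') \oc (idm X \om assoc X Y Z')
    = (idm X \om assoc X Y Z') \oc assoc X (X \ox Y) Z' \oc (swap X X Y \om idm Z')
      \oc associ X (X \ox Y) Z'.
  by rewrite -swap_assocr -[RHS]cA (associK L) cm1.
move: (swap X X Y) (swap X X _) S => p q S.
rewrite /co /cancel_tens !t1c1 !tc11 !cA (asc _ S) !cA.
have A : (idm X \om associ X Y Z') \oc (idm X \om assoc X Y Z') = idm _.
  by rewrite -t1c1 (assocK L) t11.
rewrite (asc _ A) cm1.
by rewrite (asc _ (assoc_nat L _ _ _)) (asc _ (associ_nat _ _ _)) !cA.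
Qed.

End CancelTens.

(** Under the multiplicative map [cancel_tens] the equation says that a zigzag times an endomorphism
    of X is the identity; that endomorphism is absorbed into [ev]. *)
Lemma invertible_zigzag X Y Z (u : hom Z (X \ox Y)) (v : hom (X \ox Y) Z)
    (w : hom (X \ox Z) (X \ox Z)) :
  invertible Z -> (idm X \om v) \oc swap X X Y \oc (idm X \om u) \oc w = idm _ ->
  exists (Xd : C) (co : hom unit_obj (X \ox Xd)) (ev : hom (Xd \ox X) unit_obj),
    zigzag co ev = idm X.
Proof.
move=> [Z' [eps [eta [eta_eps eps_eta]]]] /(congr1 (cancel_tens eps eta)).
rewrite cancel_tens_comp // cancel_tens1 // cancel_tens_zigzag -cA zigzag_comp => E.
(* Here [Xd] is Y (x) Z'. *)
by eexists; eexists; eexists; exact: E.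
Qed.

(** * Kelly's unit coherences *)

Lemma tens_unitl_inj X Y (f g : hom X Y) :
  idm unit_obj \om f = idm unit_obj \om g -> f = g.
Proof.
move=> E; rewrite -[f]cm1 -[g]cm1 -(lunitiK L) !cA.
by rewrite -!(lunit_nat L) E.
Qed.

Lemma tens_unitr_inj X Y (f g : hom X Y) :
  f \om idm unit_obj = g \om idm unit_obj -> f = g.
Proof.
move=> E; rewrite -[f]cm1 -[g]cm1 -(runitiK L) !cA.
by rewrite -!(runit_nat L) E.
Qed.

(** Tensoring with the unit is faithful, so the claim may be checked inside the pentagon for 1, 1,
    X, Y, where the triangle axiom applies twice. *)
Lemma lunit_tens X Y : lunit (X \ox Y) \oc assoc unit_obj X Y = lunit X \om idm Y.
Proof.
apply: tens_unitl_inj; apply: epi_assoc; apply: epi_assoc1.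
rewrite t1c1 -[LHS]cA -[LHS]cA (cA (idm unit_obj \om assoc _ _ _)) (pentagon L).
rewrite cA (triangle L) -t11 -(assoc_nat L) -(assoc_nat L) -[RHS]cA -tc11.
by rewrite (triangle L).
Qed.

Lemma runit_tens X Y : (idm X \om runit Y) \oc assoc X Y unit_obj = runit (X \ox Y).
Proof.
apply: tens_unitr_inj.
suff E : assoc X Y unit_obj \oc (((idm X \om runit Y) \oc assoc X Y unit_obj) \om idm _)
    = assoc X Y unit_obj \oc (runit (X \ox Y) \om idm unit_obj).
  by rewrite -[LHS]c1m -[RHS]c1m -(assocK L) -!cA E.
rewrite tc11 cA (assoc_nat L) -(triangle L Y) t1c1 -!cA (cA (idm X \om assoc _ _ _)).
by rewrite (pentagon L) cA -(assoc_nat L) t11 -cA (triangle L).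
Qed.

Lemma lunit_unit : lunit unit_obj = runit (unit_obj : C).
Proof.
apply: tens_unitr_inj; rewrite -lunit_tens -(triangle L); congr (_ \oc _).
rewrite -[LHS]c1m -[RHS]c1m -(lunitK L) -!cA; congr (_ \oc _).
by rewrite (lunit_nat L).
Qed.

(** * Naturality of zigzags, and idempotency of the second one *)

Lemma zigzag_slide X Y Z (co : hom unit_obj (X \ox Y)) (ev : hom (Z \ox X) unit_obj)
    (f : hom Y Z) :
  zigzag ((idm X \om f) \oc co) ev = zigzag co (ev \oc (f \om idm X)).
Proof.
by rewrite /zigzag tc11 t1c1 !cA (asc _ (assoc_nat L _ _ _)) !cA.
Qed.

Lemma zigzag_dual_precomp X Y Y' Z (co : hom unit_obj (X \ox Z))
    (ev : hom (Y \ox X) unit_obj) (f : hom Y' Y) :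
  zigzag_dual co (ev \oc (f \om idm X)) = zigzag_dual co ev \oc f.
Proof.
rewrite /zigzag_dual -[RHS]cA runiti_nat !cA tc11; congr (_ \oc _).
rewrite -[RHS]cA [in RHS]tc cm1 c1m -[in RHS](cm1 f) -[in RHS](c1m co) -[in RHS]tc !cA.
by rewrite -(t11 X Z) (asc _ (associ_nat _ _ _)) !cA.
Qed.

Lemma zigzag_dual_postcomp X Y Z Z' (co : hom unit_obj (X \ox Z))
    (ev : hom (Y \ox X) unit_obj) (g : hom Z Z') :
  zigzag_dual ((idm X \om g) \oc co) ev = g \oc zigzag_dual co ev.
Proof.
rewrite /zigzag_dual t1c1 !cA (asc _ (associ_nat _ _ _)) t11 !cA.
by rewrite (asc _ (tc _ _ _ _)) -(lunit_nat L) (asc _ (tc _ _ _ _)) !c1m !cm1.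
Qed.

(** Up to coherence both sides insert [co] between Y and X and then apply [ev] twice. *)
Lemma ev_zigzag X Y (co : hom unit_obj (X \ox Y)) (ev : hom (Y \ox X) unit_obj) :
  ev \oc (zigzag_dual co ev \om idm X) = ev \oc (idm Y \om zigzag co ev).
Proof.
have evl : ev \oc (lunit Y \om idm X) \oc ((ev \om idm Y) \om idm X)
    = lunit unit_obj \oc (ev \om ev) \oc assoc (Y \ox X) Y X.
  rewrite -lunit_tens cA -(lunit_nat L) -!cA (assoc_nat L) !cA.
  by rewrite (asc _ (tc _ _ _ _)) c1m t11 cm1.
(* The equality of the two unitors at the unit object makes this end like [evl]. *)
have evr : ev \oc (idm Y \om runit X) \oc (idm Y \om (idm X \om ev))
    = lunit unit_obj \oc (ev \om ev) \oc associ Y X (Y \ox X).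
  have -> : idm Y \om runit X = runit (Y \ox X) \oc associ Y X unit_obj.
    by rewrite -runit_tens -cA (associK L) cm1.
  rewrite cA -(runit_nat L) -lunit_unit -!cA associ_nat !cA.
  by rewrite (asc _ (tc _ _ _ _)) c1m t11 cm1.
have pent : assoc (Y \ox X) Y X \oc (associ Y X Y \om idm X)
    = associ Y X (Y \ox X) \oc (idm Y \om assoc X Y X) \oc assoc Y (X \ox Y) X.
  apply: (@epi_assoc1 _ _ _ _ _ _ X); rewrite -cA -tc11 (assocK L) !t11 cm1.
  by rewrite -!cA (cA (idm Y \om _)) (pentagon L) cA (assocK L) c1m.
have tri : assoc Y unit_obj X \oc (runiti Y \om idm X) = idm Y \om luniti X.
  rewrite -[LHS]c1m -t11 -(lunitK L) t1c1 -!cA (cA (idm Y \om lunit X)) (triangle L).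
  by rewrite -tc11 (runitiK L) t11 cm1.
rewrite /zigzag_dual /zigzag !tc11 !t1c1 !cA evl evr (asc _ pent) !cA.
by rewrite (asc _ (assoc_nat L _ _ _)) !cA (asc _ tri).
Qed.

(** One factor moves into [ev], which it leaves unchanged by [ev_zigzag]. *)
Lemma zigzag_dual_idem X Y (co : hom unit_obj (X \ox Y)) (ev : hom (Y \ox X) unit_obj) :
  zigzag co ev = idm X ->
  zigzag_dual co ev \oc zigzag_dual co ev = zigzag_dual co ev.
Proof. by move=> E; rewrite -zigzag_dual_precomp ev_zigzag E t11 cm1. Qed.

End Nuclear.

(** * From one triangle identity to a dual in the idempotent completion *)

Section KaroubiRigid.
Variables (K : comPzRingType) (C : sym_mon_cat K).

(** The underlying morphism of [b] is itself an idempotent of C, so it defines a summand; it also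
    serves as both [i] and [p]. *)
Lemma karoubi_split (P : karoubi C) (b : hom P P) : b \oc b = b ->
  exists (Q : karoubi C) (i : hom Q P) (p : hom P Q), p \oc i = idm Q /\ i \oc p = b.
Proof.
move=> bb; have vb : sm_val b \oc sm_val b = sm_val b by rewrite -kcE bb.
pose Q : karoubi C := Summand vb.
have iP : sm_val b \in @sm_hom_pred _ C Q P.
  by apply/eqP; rewrite -[LHS]/(sm_idem P \oc sm_val b \oc sm_val b) sm_homl vb.
have pP : sm_val b \in @sm_hom_pred _ C P Q.
  by apply/eqP; rewrite -[LHS]/(sm_val b \oc sm_val b \oc sm_idem P) vb sm_homr.
exists Q, (SmHom iP), (SmHom pP).
by split; apply: val_inj; rewrite -?[LHS]/(sm_val _) -?[RHS]/(sm_val _) !kE.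
Qed.

(** The dual is the image of the idempotent b = [i p] given by the second zigzag. The first zigzag
    survives since [ev] absorbs b; the second becomes [p b i = p i p i = 1]. *)
Lemma karoubi_rigid (P Q : karoubi C) (co : hom unit_obj (P \ox Q))
    (ev : hom (Q \ox P) unit_obj) :
  zigzag co ev = idm P -> rigid P.
Proof.
move=> E; have [R [i [p [pi ip]]]] := karoubi_split (zigzag_dual_idem E).
exists R, (ev \oc (i \om idm P)), ((idm P \om p) \oc co).
split; first rewrite -[LHS]/(zigzag _ _).
  by rewrite zigzag_slide -cA -tc11 ip ev_zigzag E t11 cm1.
rewrite -[LHS]/(zigzag_dual _ _) zigzag_dual_precomp zigzag_dual_postcomp.
by rewrite -ip cA pi c1m pi.
Qed.

End KaroubiRigid.

Lemma karoubi_swap (K : comPzRingType) (C : sym_mon_cat K) (X Y Z : C) :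
  let incl (W : C) : karoubi C := Summand (cm1 (idm W)) in
  sm_val (swap (incl X) (incl Y) (incl Z)) = swap X Y Z.
Proof. by move=> incl; rewrite /swap !kE /= !t11 !cm1. Qed.

(** * The relation for z inside the completion *)

Section Completion.
Variables (K : comPzRingType) (C : sym_mon_cat K).

Lemma entry_comp_single (A B D : additive_envelope C) (g : hom B D) (f : hom A B)
    (j : fam_idx B) i k : (forall l, l = j) ->
  entry (g \oc f) i k = entry g j k \oc entry f i j.
Proof.
by move=> jE; rewrite entry_comp (big_pred1 j) // => l; apply/esym/eqP.
Qed.

Lemma entry_swap (A B D : additive_envelope C) a b d :
  entry (swap A B D) (a, (b, d)) (b, (a, d)) = swap (A a) (B b) (D d).
Proof.
have ma : @is_mono K C (fam_tens A (fam_tens B D)) (fam_tens (fam_tens A B) D)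
    (associ A B D) (fun p => ((p.1, p.2.1), p.2.2))
    (fun p => associ (A p.1) (B p.2.1) (D p.2.2)).
  exact: reindexP.
have mb := is_mono_tens (mono_braid A B) (mono_idm D).
exact: (is_mono_comp (is_mono_comp (mono_assoc B A D) mb) ma).1.
Qed.

Lemma extpow_zigzag (X : C) m (r : K) (hr : (m.+1`!)%:R * r = 1) :
  let P := to_completion X in let Q := to_completion (tpow X m) in
  exists (u : hom (extpow X hr) (P \ox Q)) (v : hom (P \ox Q) (extpow X hr))
    (w : hom (P \ox extpow X hr) (P \ox extpow X hr)),
  (idm P \om v) \oc swap P P Q \oc (idm P \om u) \oc w = idm _.
Proof.
move=> P Q.
pose a := antisym X m.+1 r.
have aa : a \oc a = a by exact: antisymP.
pose PQ := (fam_single X \ox fam_single (tpow X m) : additive_envelope C).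
pose T := fam_single (tpow X m.+1).
(* [T] and [PQ] have the same underlying object but different one-point index types, so inclusion
   and projection are both the 1 by 1 matrix [a]. *)
pose u0 : hom T PQ := @mk_fam_hom K C T PQ (fun _ _ => a).
pose v0 : hom PQ T := @mk_fam_hom K C PQ T (fun _ _ => a).
have ttE : forall i : fam_idx T, i = tt by case.
pose i2 : fam_idx (fam_single X \ox T : additive_envelope C) := (tt, tt).
have i2E : forall l, l = i2 by case=> [[] []].
pose i3 : fam_idx (fam_single X \ox PQ : additive_envelope C) := (tt, (tt, tt)).
have i3E : forall l, l = i3 by case=> [[] [[] []]].
have uP : u0 \in @sm_hom_pred K _ (extpow X hr) (P \ox Q).
  apply/eqP; rewrite ktoE t11 c1m; apply: fam_homP => i j.
  by rewrite (entry_comp_single _ _ _ _ ttE) !entry_mk.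
have vP : v0 \in @sm_hom_pred K _ (P \ox Q) (extpow X hr).
  apply/eqP; rewrite ktoE t11 cm1; apply: fam_homP => i j.
  by rewrite (entry_comp_single _ _ _ _ ttE) !entry_mk.
pose u : hom (extpow X hr) (P \ox Q) := SmHom uP.
pose v : hom (P \ox Q) (extpow X hr) := SmHom vP.
pose z := (idm P \om v) \oc swap P P Q \oc (idm P \om u).
(* With n = m + 1, the relation n z^2 + (n - 1) z = 1 reads z (n z + (n - 1)) = 1. *)
exists u, v, (m.+1%:R *: z + m%:R *: idm _).
rewrite compDr !compZr cm1 -/z.
have uE i j : entry (sm_val u) i j = a by exact: entry_mk.
have vE i j : entry (sm_val v) i j = a by exact: entry_mk.
have pE i j : entry (sm_val (idm P)) i j = idm X.
  by rewrite kidE; case: i j => -[]; exact: entry_idm.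
have zE : entry (sm_val z) i2 i2
    = (idm X \om a) \oc swap X X (tpow X m) \oc (idm X \om a).
  rewrite /z kcE (kcE (idm P \om v)) !ktE karoubi_swap.
  by rewrite !(entry_comp_single _ _ _ _ i3E) entry_swap !entry_tens uE vE !pE.
(* All index types are singletons, so one entry determines a morphism. *)
have ext (f g : hom (P \ox extpow X hr) (P \ox extpow X hr)) :
    entry (sm_val f) i2 i2 = entry (sm_val g) i2 i2 -> f = g.
  by move=> E; apply: val_inj; apply: fam_homP => i j; rewrite [i]i2E [j]i2E.
apply: ext; rewrite kidE sm_val_lin entryD !entryZ.
rewrite kcE (entry_comp_single _ _ _ _ i2E) [\val z]/(sm_val z) zE.
have -> : entry (sm_idem (P \ox extpow X hr)) i2 i2 = idm X \om a.
  by rewrite entry_tens -(pE tt tt) kidE; congr (_ \om _); exact: entry_mk.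
(* The identity of the summand is 1 (x) [a], the right side of [antisym_swap]; the doubled [a] in
   z^2 collapses. *)
rewrite -[RHS](antisym_swap X hr) -/a; congr (_ *: _ + _).
by rewrite !cA -(cA _ (idm X \om a) (idm X \om a)) -t1c1 aa.
Qed.

End Completion.

(** * Rigidity from an invertible exterior power *)

Theorem theorem2p1p1 (n : nat) (hn : (2 <= n)%N) (K : comPzRingType)
    (r : K) (hr : (n`!)%:R * r = 1) (C : sym_mon_cat K) (X : C) :
  invertible (extpow X hr) -> rigid (to_completion X).
Proof.
(* Writing n = m + 1 exposes the first factor of X^n. *)
case: n hn hr => // m _ hr inv.
have [u [v [w zw]]] := extpow_zigzag X hr.
have [Xd [co [ev E]]] := invertible_zigzag inv zw.
exact: karoubi_rigid E.
Qed.
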